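(* Let $b>0$ and let $\Delta\in\mathbb{N}$. Let $G_n=(V_n,E_n)$, $n\ge 1$, be a sequence of finite graphs with maximum degree at most $\Delta$, each of which is a vertex $b$-expander, with $|V_n|\to\infty$. Let $0\le p_n\le 1$ for each $n$ and let $c>0$. Then $$\mathbb{P}\big(G_n(p_n)\text{ contains more than one connected component of order at least } c|V_n|\big)\to 0$$ as $n\to\infty$.
   Context: For a graph $G$ and $p\in[0,1]$, $G(p)$ denotes the random spanning subgraph of $G$ obtained by retaining each edge of $G$ independently with probability $p$. The order of a component is its number of vertices. For a finite graph $G=(V,E)$ and $A\subseteq V$, the external boundary $\partial A$ is the set of vertices outside $A$ having a neighbor in $A$. The vertex isoperimetric constant is $\iota(G)=\min\{|\partial A|/|A| : A\subset V,\ 0<|A|\le |V|/2\}$, and $G$ is a vertex $b$-expander if $\iota(G)\ge b$. *)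

(* Defs.v *)
From mathcomp Require Import all_boot all_order all_algebra.
From mathcomp Require Import all_classical all_reals all_analysis.

Set Implicit Arguments.
Unset Strict Implicit.
Unset Printing Implicit Defensive.

Import Order.TTheory GRing.Theory Num.Theory.
Import numFieldNormedType.Exports.

Local Open Scope ring_scope.

Record sgraph := SGraph {
  vertex :> finType;
  adj : rel vertex;
  adj_sym : symmetric adj;
  adj_irr : irreflexive adj }.

Arguments adj {s} : rename.

Section Graph.
Variable G : sgraph.
Implicit Types (A : {set G}) (F : {set {set G}}).

Definition edges : {set {set G}} :=
  [set e | [exists x : G, exists y : G, adj x y && (e == [set x; y]%SET)]]%SET.

Definition degree (x : G) : nat := #|[set y : G | adj x y]%SET|.

Definition max_degree : nat := (\max_(x : G) degree x)%N.

Definition ext_boundary A : {set G} :=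
  [set y : G | (y \notin A) && [exists x in A, adj x y]]%SET.

Definition components : {set {set G}} :=
  [set [set y : G | connect adj x y] | x : G]%SET.

Definition sub_adj F : rel G := fun x y => adj x y && ([set x; y]%SET \in F).

Lemma sub_adj_sym F : symmetric (sub_adj F).
Proof. by move=> x y; rewrite /sub_adj adj_sym finset.setUC. Qed.

Lemma sub_adj_irr F : irreflexive (sub_adj F).
Proof. by move=> x; rewrite /sub_adj adj_irr. Qed.

Definition spanning_subgraph F : sgraph :=
  SGraph (sub_adj_sym F) (sub_adj_irr F).

Variable R : realType.

(* The minimum is taken in the extended reals, so that it is +oo when no set A
   is admissible, which happens only if G has at most one vertex. *)
Definition vertex_iso_const : \bar R :=
  (\big[Order.min/+oo]_(A : {set G}
      | (0 < #|A|)%N && (#|A|%:R <= #|G|%:R / 2 :> R)%R)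
     (#|ext_boundary A|%:R / #|A|%:R)%:E)%E.

Definition vertex_expander (b : R) : Prop := (b%:E <= vertex_iso_const)%E.

(* Probability that exactly the edges of F, a subset of edges, are retained. *)
Definition retain_prob (p : R) F : R :=
  \prod_(e in edges) (if e \in F then p else 1 - p).

Definition perc_prob (p : R) (Q : pred sgraph) : R :=
  \sum_(F in powerset edges | Q (spanning_subgraph F)) retain_prob p F.

End Graph.

Definition several_large_components (R : realType) (s : R) : pred sgraph :=
  fun H => (1 < #|[set C in components H | (s <= #|C|%:R)%R]%SET|)%N.

(* Main.v *)
(* Let S and T be the clusters of x and y, distinct and both of order at least
   c n. If T is revealed on its own, the number of open edges touching T is
   close to p times the number of edges touching T. If S is revealed first,
   the edges not touching S are still fresh, so the same number of open
   edges is close to p times the number of edges touching T but not S.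
   Comparing the two, few edges touch both S and T, hence few vertices of T
   are adjacent to S. The same comparison for the edges touching the ball of
   radius k around S shows that if T has few vertices in this ball, then it
   has few in the ball of radius k + 1. By expansion a ball of bounded
   radius around S misses at most c n / 2 vertices, a contradiction. When p
   is too small for this iteration, T has too few edges to be connected. All
   deviations have exponentially small probability, so a union bound over x
   and y suffices. *)
Require Import Defs.
From mathcomp Require Import all_boot all_order all_algebra.
From mathcomp Require Import all_classical all_reals all_analysis.
From mathcomp Require Import fintype finset zify lra ring.

Set Implicit Arguments.
Unset Strict Implicit.
Unset Printing Implicit Defensive.

Import Order.TTheory GRing.Theory Num.Theory.
Import numFieldNormedType.Exports.

Local Open Scope ring_scope.
Local Open Scope set_scope.

(** * Product measures on the subsets of a finite set *)

Section ProductMeasure.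
Variables (R : realType) (K : finType) (E : {set K}).
Implicit Types (q : K -> R) (Q : pred {set K}) (D A F : {set K}).

Definition edge_weight (a : R) (open : bool) : R := if open then a else 1 - a.

(** The parameter may vary with the edge, so that a measure tilted on some edges only is again of
    this form. *)
Definition mass q F : R := \prod_(e in E) edge_weight (q e) (e \in F).

Definition Pr q Q : R := \sum_(F in powerset E | Q F) mass q F.

Definition determined D Q : Prop := forall F, F \subset E -> Q F = Q (F :&: D).

(** Expand a product of two-term sums over subsets, giving weight 0 to every choice on [D] that
    contradicts [F1]. *)
Lemma sum_mass_trace q D F1 : F1 \subset E :&: D ->
  \sum_(F in powerset E | F :&: D == F1) mass q F
  = \prod_(e in E :&: D) edge_weight (q e) (e \in F1).
Proof.
move=> sF1.
(* [a] weighs the choice of [e] in [F] and [b] that of [e] outside [F]. Off [E] the weights are 0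
   and 1, so only subsets of [E] contribute. *)
pose a e : R := if e \in E then
  (if e \in D then (if e \in F1 then q e else 0) else q e) else 0.
pose b e : R := if e \in E then
  (if e \in D then (if e \in F1 then 0 else 1 - q e) else 1 - q e) else 1.
transitivity (\prod_e (a e + b e)); last first.
  rewrite [RHS]big_mkcond /=; apply: eq_bigr => e _.
  rewrite /a /b inE; case: (e \in E) => /=; last by rewrite add0r.
  case: (e \in D) => /=; last by rewrite addrC subrK.
  by case: (e \in F1); rewrite /edge_weight ?addr0 ?add0r.
rewrite bigA_distr big_mkcond /=; apply: eq_bigr => F _.
rewrite powersetE; case: (boolP (F \subset E)) => /= [sF|]; last first.
  case/subsetPn => e eF eE.
  by rewrite (bigD1 e) //= eF /a (negPf eE) mul0r.
case: eqP => [eqF|neF].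
  rewrite /mass big_mkcond /=; apply: eq_bigr => e _.
  have := congr1 (fun B : {set K} => e \in B) eqF; rewrite inE /= => eD.
  have := subsetP sF e; rewrite /a /b /edge_weight -eD.
  by case: (e \in E); case: (e \in F); case: (e \in D) => // /(_ isT).
have /existsP[e eP] : [exists e, (e \in F :&: D) != (e \in F1)].
  rewrite -negb_forall; apply/negP => /forallP H.
  by apply: neF; apply/setP => e; apply/eqP.
have eED : (e \in E) && (e \in D).
  move: eP; rewrite inE; have := subsetP sF e; have := subsetP sF1 e.
  rewrite inE; move: (e \in E) (e \in D) (e \in F1) (e \in F).
  by do 4!case=> //; first [by move=> /(_ isT) | by move=> _ /(_ isT)].
case/andP: eED => eE eD.
rewrite (bigD1 e) //= /a /b eE eD; move: eP; rewrite inE eD andbT.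
by case: (e \in F); case: (e \in F1) => //=; rewrite mul0r.
Qed.

(** Grouping the sets by their trace on [D] sums out the parameters off [D]. Thus a tilt can be
    added or removed on edges that the event does not read. *)
Lemma Pr_determined q q' D Q : determined D Q ->
  (forall e, e \in E -> e \in D -> q e = q' e) -> Pr q Q = Pr q' Q.
Proof.
move=> dQ eqq.
have PrE r : Pr r Q = \sum_(F1 in powerset (E :&: D) | Q F1)
    \prod_(e in E :&: D) edge_weight (r e) (e \in F1).
  rewrite /Pr (partition_big (fun F => F :&: D)
    (fun F1 => (F1 \in powerset (E :&: D)) && Q F1)) /=; last first.
    move=> F /andP[]; rewrite !powersetE => sF QF.
    by rewrite setSI //= -dQ.
  apply: eq_bigr => F1 /andP[]; rewrite powersetE => sF1 QF1.
  rewrite -sum_mass_trace //; apply: eq_bigl => F; rewrite powersetE.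
  case: (boolP (F \subset E)) => //= sF; case: eqP => [eqF|]; rewrite ?andbF //.
  by rewrite (dQ _ sF) eqF QF1.
rewrite !PrE; apply: eq_bigr => F1 _; apply: eq_bigr => e.
by rewrite inE => /andP[eE eD]; rewrite eqq.
Qed.

Lemma Pr_predT q : Pr q predT = 1.
Proof.
have -> : Pr q predT = \sum_(F in powerset E | F :&: set0 == set0) mass q F.
  by apply: eq_bigl => F; rewrite setI0 eqxx.
by rewrite sum_mass_trace ?sub0set // setI0 big_set0.
Qed.

Lemma mass_ge0 q F : (forall e, 0 <= q e <= 1) -> 0 <= mass q F.
Proof.
move=> q01; apply: prodr_ge0 => e _; have /andP[q0 q1] := q01 e.
by rewrite /edge_weight; case: ifP => // _; rewrite subr_ge0.
Qed.

Lemma Pr_le q Q Q' : (forall e, 0 <= q e <= 1) ->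
  (forall F, F \subset E -> Q F -> Q' F) -> Pr q Q <= Pr q Q'.
Proof.
move=> q01 QQ'; rewrite /Pr big_mkcond [leRHS]big_mkcond /=.
apply: ler_sum => F _; rewrite powersetE.
case: (boolP (F \subset E)) => //= sF; case: (boolP (Q F)) => [QF|_].
  by rewrite QQ'.
by case: ifP => // _; apply: mass_ge0.
Qed.

Lemma Pr_exists (I : finType) q (Q : I -> pred {set K}) :
  (forall e, 0 <= q e <= 1) ->
  Pr q (fun F => [exists i, Q i F]) <= \sum_i Pr q (Q i).
Proof.
move=> q01; rewrite /Pr [leRHS](eq_bigr (fun i =>
  \sum_(F in powerset E) if Q i F then mass q F else 0)); last first.
  by move=> i _; rewrite big_mkcondr.
rewrite exchange_big /= big_mkcondr /=; apply: ler_sum => F _.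
case: existsP => [[i QiF]|_].
  rewrite (bigD1 i) //= QiF lerDl; apply: sumr_ge0 => j _.
  by case: ifP => // _; apply: mass_ge0.
by apply: sumr_ge0 => j _; case: ifP => // _; apply: mass_ge0.
Qed.

Lemma Pr_partition (I : finType) q Q (X : {set K} -> I) :
  Pr q Q = \sum_i Pr q (fun F => Q F && (X F == i)).
Proof.
rewrite /Pr (partition_big X predT) //=; apply: eq_bigr => i _.
by apply: eq_bigl => F; rewrite andbA.
Qed.

Lemma Pr_or q Q Q' : (forall e, 0 <= q e <= 1) ->
  Pr q (fun F => Q F || Q' F) <= Pr q Q + Pr q Q'.
Proof.
move=> q01.
have := @Pr_exists bool q (fun b => if b then Q else Q') q01.
rewrite big_bool /=; apply: le_trans; apply: Pr_le => // F _.
by case/orP=> QF; apply/existsP; [exists true|exists false].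
Qed.

End ProductMeasure.

(** * Exponential tilting and a Chernoff bound for explored edges *)

Section ExponentialTilting.
Variable R : realType.
Implicit Types p lam x : R.

(** From $e^{-x} \ge 1-x$ comes $e^x \le 1/(1-x)$, and $(1+x+2x^2)(1-x) = 1+x^2(1-2x) \ge 1$. *)
Lemma expR_le_quadratic x : x <= 1 / 2 -> expR x <= 1 + x + 2 * x ^+ 2.
Proof.
move=> x2; have x1 : 0 < 1 - x by lra.
have e1 : expR x <= (1 - x)^-1.
  rewrite -[x in expR x]opprK expRN lef_pV2 ?posrE ?expR_gt0 //.
  exact: expR_ge1Dx.
apply: (le_trans e1); rewrite -[leLHS]mul1r ler_pdivrMr //.
have : 0 <= x ^+ 2 * (1 - 2 * x) by apply: mulr_ge0; [exact: sqr_ge0 | lra].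
have -> : (1 + x + 2 * x ^+ 2) * (1 - x) = 1 + x ^+ 2 * (1 - 2 * x) by ring.
lra.
Qed.

Definition bernoulli_mgf p lam : R :=
  p * expR (lam * (1 - p)) + (1 - p) * expR (lam * (0 - p)).

Lemma bernoulli_mgf_gt0 p lam : 0 <= p <= 1 -> 0 < bernoulli_mgf p lam.
Proof.
case/andP=> p0 p1; rewrite /bernoulli_mgf.
have [->|pn0] := eqVneq p 0.
  by rewrite mul0r add0r subr0 mul1r expR_gt0.
apply: ltr_wpDr; first by rewrite mulr_ge0 ?expR_ge0 ?subr_ge0.
by rewrite mulr_gt0 ?expR_gt0 // lt0r pn0.
Qed.

(** The variable is centred, so the linear terms cancel and the quadratic ones leave $2\lambda^2
    p(1-p)$. *)
Lemma bernoulli_mgf_le p lam : 0 <= p <= 1 -> `|lam| <= 1 / 2 ->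
  bernoulli_mgf p lam <= expR (2 * lam ^+ 2).
Proof.
case/andP=> p0 p1 /ler_normlP[l1 l2].
have e1 : expR (lam * (1 - p)) <=
    1 + lam * (1 - p) + 2 * (lam * (1 - p)) ^+ 2.
  by apply: expR_le_quadratic; nra.
have e2 : expR (lam * (0 - p)) <= 1 + lam * (0 - p) + 2 * (lam * (0 - p)) ^+ 2.
  by apply: expR_le_quadratic; nra.
apply: le_trans (expR_ge1Dx _); rewrite /bernoulli_mgf.
apply: le_trans (lerD (ler_wpM2l p0 e1) (ler_wpM2l _ e2)) _; first lra.
have -> : p * (1 + lam * (1 - p) + 2 * (lam * (1 - p)) ^+ 2) +
  (1 - p) * (1 + lam * (0 - p) + 2 * (lam * (0 - p)) ^+ 2) =
  1 + 2 * lam ^+ 2 * (p * (1 - p)) by ring.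
rewrite lerD2l -[leRHS]mulr1 ler_wpM2l //.
  by apply: mulr_ge0; rewrite ?sqr_ge0.
have := sqr_ge0 p; rewrite expr2; lra.
Qed.

(** Success probability of the Bernoulli law of $X$ reweighted by $e^{\lambda(X-p)}$. *)
Definition tilt p lam : R := p * expR (lam * (1 - p)) / bernoulli_mgf p lam.

Lemma edge_weight_tilt p lam (o : bool) : 0 <= p <= 1 ->
  edge_weight (tilt p lam) o =
  edge_weight p o * (expR (lam * (o%:R - p)) / bernoulli_mgf p lam).
Proof.
move=> p01; have m0 := lt0r_neq0 (bernoulli_mgf_gt0 lam p01).
rewrite /edge_weight /tilt; case: o => /=; first by rewrite mulrA.
by apply: (mulIf m0); rewrite mulrA mulrBl !divfK // mul1r /bernoulli_mgf; ring.
Qed.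

Lemma tilt01 p lam : 0 <= p <= 1 -> 0 <= tilt p lam <= 1.
Proof.
move=> p01; have m0 := bernoulli_mgf_gt0 lam p01; case/andP: p01 => p0 p1.
rewrite /tilt divr_ge0 ?mulr_ge0 ?expR_ge0 ?(ltW m0) //=.
by rewrite ler_pdivrMr // mul1r lerDl mulr_ge0 ?expR_ge0 ?subr_ge0.
Qed.

Variables (K : finType) (E : {set K}).
Implicit Types (Q : pred {set K}) (A D F : {set K}).

Definition deviation p A F : R := #|A :&: F|%:R - p * #|A|%:R.

(** The density of the tilted measure is a product of one-edge densities over [A], whose exponents
    add up to the deviation. *)
Lemma mass_tilt p lam A F : 0 <= p <= 1 -> A \subset E ->
  mass E (fun e => if e \in A then tilt p lam else p) F =
  mass E (fun=> p) F *
    (expR (lam * deviation p A F) / bernoulli_mgf p lam ^+ #|A|).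
Proof.
move=> p01 sA; set M := bernoulli_mgf p lam.
transitivity (mass E (fun=> p) F *
    \prod_(e in A) (expR (lam * ((e \in F)%:R - p)) / M)).
  rewrite /mass (big_setID A) [in RHS](big_setID A) /= (setIidPr sA).
  rewrite -mulrA [X in _ = _ * X]mulrC mulrA -big_split /=; congr (_ * _).
    by apply: eq_bigr => e eA; rewrite eA edge_weight_tilt.
  by apply: eq_bigr => e; rewrite inE => /andP[/negPf->].
congr (_ * _); rewrite big_split /= prodr_const exprVn; congr (_ / _).
rewrite -expR_sum -mulr_sumr; congr (expR (_ * _)).
rewrite sumrB sumr_const -[p *+ _]mulr_natr /deviation; congr (_ - _).
rewrite -natr_sum -sum1_card; congr (_%:R).
rewrite big_mkcond [in RHS]big_mkcond /=; apply: eq_bigr => e _.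
by rewrite inE; case: (e \in A); case: (e \in F).
Qed.

(* Tilting the edges of [A] multiplies the probability of each [F] with
   [X F = i] by [exp (lam * deviation)] up to normalisation, provided that only
   the edges of [D i] are tilted; tilting the other edges of [A] does not change
   the probability of [X = i]. *)
Lemma chernoff (I : finType) p lam t A D' (X : {set K} -> I) (D : I -> {set K})
    Q : 0 <= p <= 1 -> `|lam| <= 1 / 2 -> A \subset E -> [disjoint A & D'] ->
  determined E D' Q ->
  (forall i, determined E (D' :|: D i) (fun F => Q F && (X F == i))) ->
  Pr E (fun=> p) (fun F => Q F && (t <= lam * deviation p (A :&: D (X F)) F))
  <= expR (2 * lam ^+ 2 * #|E|%:R - t) * Pr E (fun=> p) Q.
Proof.
move=> p01 lam2 sA dA dQ dX.
pose q e := if e \in A then tilt p lam else p.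
(* [Q] reads only [D'], which avoids the tilted set [A]. *)
have -> : Pr E (fun=> p) Q = Pr E q Q.
  apply: (Pr_determined dQ) => e eE eD'; rewrite /q; case: ifP => // eA.
  by have := disjoint_setI0 dA => /setP/(_ e); rewrite !inE eA eD'.
rewrite (Pr_partition _ _ _ X) [in leRHS](Pr_partition _ _ _ X) mulr_sumr.
apply: ler_sum => i _.
(* On [X = i] the edges of [A] outside [D i] are not read, so the tilt can be confined to
   [A :&: D i]; the density then involves exactly the deviation in the event. *)
pose r e := if e \in A :&: D i then tilt p lam else p.
have -> : Pr E q (fun F => Q F && (X F == i)) =
          Pr E r (fun F => Q F && (X F == i)).
  apply: (Pr_determined (dX i)) => e eE; rewrite /q /r !inE.
  case: (boolP (e \in A)) => //= eA; case: (e \in D i); rewrite ?orbT // orbF.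
  by move=> eD'; have := disjoint_setI0 dA => /setP/(_ e); rewrite !inE eA eD'.
have r01 e : 0 <= r e <= 1 by rewrite /r; case: ifP => // _; exact: tilt01.
rewrite /Pr mulr_sumr big_mkcond [leRHS]big_mkcond /=; apply: ler_sum => F _.
case: (F \in powerset E) => //=; case: (Q F) => //=.
case: eqP => [XF|_]; last by rewrite andbF.
rewrite andbT; case: ifP => [tF|_]; last first.
  by rewrite mulr_ge0 ?expR_ge0 // mass_ge0.
rewrite mass_tilt //; last by rewrite (subset_trans (subsetIl _ _)).
rewrite mulrCA -[leLHS]mulr1 ler_wpM2l //; first exact: mass_ge0.
have m0 := bernoulli_mgf_gt0 lam p01.
rewrite mulrA ler_pdivlMr ?exprn_gt0 // mul1r -expRD.
(* The event absorbs [t]. What remains is the normalisation, at most [#|E|] factors each bounded by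
   [bernoulli_mgf_le]. *)
apply: (@le_trans _ _ (expR (2 * lam ^+ 2 * #|E|%:R))); last first.
  by rewrite ler_expR; rewrite XF in tF; lra.
rewrite -[2 * _ * _]mulrC expRM_natl.
apply: (@le_trans _ _ (expR (2 * lam ^+ 2) ^+ #|A :&: D i|)).
  apply: lerXn2r; rewrite ?nnegrE ?expR_ge0 ?(ltW m0) //.
  exact: bernoulli_mgf_le.
apply: ler_weXn2l.
  by rewrite -expR0 ler_expR; apply: mulr_ge0; rewrite ?sqr_ge0.
by apply: subset_leq_card; rewrite (subset_trans (subsetIl _ _)).
Qed.

End ExponentialTilting.

(** * Percolation clusters and the edges they reveal *)

Section Clusters.
Variable G : sgraph.
Implicit Types (F : {set {set G}}) (S T U W : {set G}) (x y : G).

Definition perc_cluster F x : {set G} := [set y | connect (sub_adj F) x y].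

Definition touch U : {set {set G}} := [set e in edges G | ~~ [disjoint e & U]].

Lemma edgesP e :
  reflect (exists x y, adj x y /\ e = [set x; y]) (e \in edges G).
Proof.
rewrite inE; apply: (iffP existsP) => [[x /existsP[y /andP[xy /eqP->]]]|].
  by exists x, y.
by case=> x [y [xy ->]]; exists x; apply/existsP; exists y; rewrite xy eqxx.
Qed.

Lemma in_touch e U : (e \in touch U) = (e \in edges G) && ~~ [disjoint e & U].
Proof. exact: in_set. Qed.

Lemma touch_sub U : touch U \subset edges G.
Proof. by apply/subsetP => e; rewrite in_touch => /andP[]. Qed.

Lemma touchP e U :
  reflect (e \in edges G /\ exists2 x, x \in e & x \in U) (e \in touch U).
Proof.
rewrite in_touch -setI_eq0; apply: (iffP andP) => -[eE].
  by case/set0Pn => x /setIP[xe xU]; split=> //; exists x.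
by case=> x xe xU; split=> //; apply/set0Pn; exists x; rewrite inE xe.
Qed.

Lemma adj_touch U x y : adj x y -> x \in U -> [set x; y] \in touch U.
Proof.
move=> xy xU; apply/touchP; split; first by apply/edgesP; exists x, y.
by exists x => //; rewrite !inE eqxx.
Qed.

Lemma adj_touchr U x y : adj x y -> y \in U -> [set x; y] \in touch U.
Proof. by rewrite adj_sym setUC; apply: adj_touch. Qed.

Lemma mem_cluster F x : x \in perc_cluster F x.
Proof. by rewrite inE connect0. Qed.

Lemma cluster_closed F x u v :
  u \in perc_cluster F x -> sub_adj F u v -> v \in perc_cluster F x.
Proof. by rewrite !inE => xu uv; apply: connect_trans xu (connect1 uv). Qed.

Lemma cluster_sub F x U : x \in U ->
  (forall u v, u \in U -> sub_adj F u v -> v \in U) ->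
  perc_cluster F x \subset U.
Proof.
move=> xU closU; apply/subsetP => y; rewrite inE => /connectP[s].
elim: s x xU => [|z s IHs] x xU /= => [_ ->//|/andP[xz zs] yE].
exact: (IHs z (closU _ _ xU xz)).
Qed.

Lemma cluster_eq F x y :
  y \in perc_cluster F x -> perc_cluster F y = perc_cluster F x.
Proof.
rewrite inE => xy; apply/setP => z; rewrite !inE.
by apply/esym/(same_connect _ xy)/sym_connect_sym/sub_adj_sym.
Qed.

Lemma cluster_disjoint F x y :
  perc_cluster F x != perc_cluster F y ->
  [disjoint perc_cluster F x & perc_cluster F y].
Proof.
apply: contraR => /pred0Pn[z /andP[/= zx zy]].
by rewrite -(cluster_eq zx) (cluster_eq zy).
Qed.

(** The two configurations agree on all edges at the cluster. Hence the cluster is closed under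
    [F'], and its intersection with the new cluster is closed under [F]. *)
Lemma cluster_local F F' x :
  F :&: touch (perc_cluster F x) = F' :&: touch (perc_cluster F x) ->
  perc_cluster F' x = perc_cluster F x.
Proof.
move=> eqF.
have eqFe e : e \in touch (perc_cluster F x) -> (e \in F) = (e \in F').
  by move=> eT; move/setP/(_ e): eqF; rewrite 2!in_setI eT !andbT.
have sub_eq u v : u \in perc_cluster F x -> sub_adj F u v = sub_adj F' u v.
  by move=> ux; rewrite /sub_adj; case: (boolP (adj u v)) => //= uv;
     rewrite eqFe // adj_touch.
apply/eqP; rewrite eqEsubset; apply/andP; split.
  apply: cluster_sub (mem_cluster F x) _ => u v ux; rewrite -sub_eq //.
  exact: cluster_closed.
suff: perc_cluster F x \subset perc_cluster F x :&: perc_cluster F' x.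
  by rewrite subsetI => /andP[].
apply: cluster_sub; first by rewrite inE !mem_cluster.
move=> u v /setIP[ux ux'] uv; rewrite inE (cluster_closed ux uv) /=.
by apply: cluster_closed ux' _; rewrite -sub_eq.
Qed.

(** Revealing a cluster reads only the edges touching it, so conditioning on it leaves all other
    edges fresh. *)
Lemma cluster_determined x S :
  determined (edges G) (touch S) (fun F => perc_cluster F x == S).
Proof.
move=> F _; apply/eqP/eqP => [<-|eqS].
  by apply: cluster_local; rewrite -setIA setIid.
by rewrite -eqS; apply: cluster_local; rewrite eqS -setIA setIid.
Qed.

Lemma open_touch_sub F y e :
  e \in F -> e \in touch (perc_cluster F y) -> e \subset perc_cluster F y.
Proof.
move=> eF /touchP[/edgesP[u [v [uv eE]]] [w]]; rewrite eE !inE => we wT.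
have uvF : sub_adj F u v by rewrite /sub_adj uv -eE.
have vuF : sub_adj F v u by rewrite sub_adj_sym.
have [uT vT] : u \in perc_cluster F y /\ v \in perc_cluster F y.
  case/orP: we => /eqP wE; subst w.
    by split; [rewrite inE|apply: cluster_closed uvF; rewrite inE].
  by split; [apply: cluster_closed vuF; rewrite inE|rewrite inE].
by apply/subsetP => z; rewrite !inE => /orP[] /eqP->; rewrite -in_set.
Qed.

Lemma card_le_cover W (E' : {set {set G}}) : E' \subset edges G ->
  (forall v, v \in W -> exists2 e, e \in E' & v \in e) ->
  (#|W| <= 2 * #|E'|)%N.
Proof.
move=> sE' cov.
have sW : W \subset cover E'.
  by apply/subsetP => v /cov[e eE' ve]; apply/bigcupP; exists e.
apply: leq_trans (subset_leq_card sW) _.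
apply: leq_trans (leq_card_cover E') _.
rewrite mulnC -sum_nat_const; apply: leq_sum => e.
move=> /(subsetP sE')/edgesP[u [v [_ ->]]].
by rewrite cards2; case: eqP.
Qed.

Lemma card_touch Delta U : (max_degree G <= Delta)%N ->
  (#|touch U| <= Delta * #|U|)%N.
Proof.
move=> degD.
have sT : touch U \subset
    \bigcup_(u in U) [set [set u; v] | v in [set v | adj u v]].
  apply/subsetP => e /touchP[/edgesP[u [v [uv ->]]] [w]].
  rewrite !inE => /orP[]/eqP-> wU; apply/bigcupP.
    by exists u => //; apply/imsetP; exists v; rewrite ?inE.
  by exists v => //; apply/imsetP; exists u; rewrite ?inE 1?adj_sym // setUC.
apply: leq_trans (subset_leq_card sT) _.
rewrite mulnC -sum_nat_const.
elim/big_rec2: _ => [|u n B _ leBn]; first by rewrite cards0.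
apply: leq_trans (leq_card_setU _ _) _; apply: leq_add => //.
apply: leq_trans (leq_imset_card _ _) _; apply: leq_trans degD.
exact: (leq_bigmax u).
Qed.

Lemma touchT : touch [set: G] = edges G.
Proof.
apply/eqP; rewrite eqEsubset touch_sub; apply/subsetP => e eE.
by case/edgesP: (eE) => u [v [uv ->]]; apply: adj_touch; rewrite ?inE.
Qed.

Definition graph_ball k S : {set G} := iter k (fun B => B :|: ext_boundary B) S.

Lemma ball_sub k j S : (j <= k)%N -> graph_ball j S \subset graph_ball k S.
Proof.
move/subnK <-; elim: (k - j)%N => //= i IHi.
by apply: subset_trans IHi _; apply: subsetUl.
Qed.

End Clusters.

(** * Deviations of open edge counts at explored clusters *)

Section LargeClusters.
Variables (R : realType) (G : sgraph).
Implicit Types (F : {set {set G}}) (S T U W : {set G}) (x y : G) (p lam t : R).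

(** This is [chernoff] with nothing revealed beforehand and the cluster of [y] as the
    exploration. *)
Lemma cluster_deviation p lam t y : 0 <= p <= 1 -> `|lam| <= 1 / 2 ->
  Pr (edges G) (fun=> p)
    (fun F => t <= lam * deviation p (touch (perc_cluster F y)) F)
  <= expR (2 * lam ^+ 2 * #|edges G|%:R - t).
Proof.
move=> p01 lam2.
have dT : determined (edges G) set0 predT by [].
have d0 : [disjoint edges G & (set0 : {set {set G}})].
  by rewrite -setI_eq0 setI0.
have dX i : determined (edges G) (set0 :|: touch i)
    (fun F => predT F && (perc_cluster F y == i)).
  by move=> F sF; rewrite set0U /=; apply: cluster_determined.
have := chernoff t p01 lam2 (subxx (edges G)) d0 dT dX.
rewrite Pr_predT mulr1; apply: le_trans; apply: Pr_le => // F sF /=.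
by rewrite (setIidPr (touch_sub _)).
Qed.

(** Conditioning on the cluster [S] of [x] leaves [A S] fresh, and exploring the cluster of [y] then
    reads only those edges of [A S] that touch it. [chernoff] applies for each [S], and the
    probabilities of the values of [S] sum to 1. *)
Lemma fresh_deviation p lam t (A : {set G} -> {set {set G}}) x y :
  0 <= p <= 1 -> `|lam| <= 1 / 2 ->
  (forall S, A S \subset edges G :\: touch S) ->
  Pr (edges G) (fun=> p) (fun F =>
    t <= lam *
      deviation p (A (perc_cluster F x) :&: touch (perc_cluster F y)) F)
  <= expR (2 * lam ^+ 2 * #|edges G|%:R - t).
Proof.
move=> p01 lam2 sA; rewrite (Pr_partition _ _ _ (fun F => perc_cluster F x)).
apply: (@le_trans _ _ (\sum_S expR (2 * lam ^+ 2 * #|edges G|%:R - t) *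
    Pr (edges G) (fun=> p) (fun F => perc_cluster F x == S))); last first.
  rewrite -mulr_sumr -[leRHS]mulr1; apply: ler_wpM2l; first exact: expR_ge0.
  by rewrite -(Pr_partition _ _ predT (fun F => perc_cluster F x)) Pr_predT.
apply: ler_sum => S _.
have [sAE dA] : A S \subset edges G /\ [disjoint A S & touch S].
  by apply/andP; rewrite -subsetD.
have dX T : determined (edges G) (touch S :|: touch T)
    (fun F => (perc_cluster F x == S) && (perc_cluster F y == T)).
  move=> F sF; rewrite (cluster_determined x S sF) (cluster_determined y T sF).
  have sI U W : (F :&: (touch U :|: touch W)) :&: touch U = F :&: touch U.
    by rewrite -setIA setIUl setIid (setUidPl (subsetIr _ _)).
  have sF' : F :&: (touch S :|: touch T) \subset edges G.
    by rewrite (subset_trans (subsetIl _ _)).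
  rewrite (cluster_determined x S sF') (cluster_determined y T sF') sI.
  by rewrite setUC sI.
have := chernoff t p01 lam2 sAE dA (cluster_determined x S) dX.
apply: le_trans; apply: Pr_le => // F sF /andP[tF /eqP xS].
by rewrite xS eqxx /= -xS.
Qed.

(** Excluding the first and third events bounds the part of [T] next to [S]; excluding the second
    bounds [T] when [p] is small; excluding the last ones carries the bound from radius [k.+1] to
    radius [k.+2]. *)
Definition bad_pair p t L x y F : bool :=
  let S := perc_cluster F x in let T := perc_cluster F y in
  [|| deviation p (touch T) F <= - t, t <= deviation p (touch T) F,
      t <= deviation p ((edges G :\: touch S) :&: touch T) F
    | [exists k : 'I_L,
        deviation p ((touch (graph_ball k.+1 S) :\: touch S) :&: touch T) F
          <= - t]].

(** Each of the [L + 3] events costs one deviation bound, with parameter [eta] for an excess of open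
    edges and [- eta] for a deficit. *)
Lemma bad_pair_prob p t eta L x y : 0 <= p <= 1 -> 0 < eta -> eta <= 1 / 2 ->
  Pr (edges G) (fun=> p) (bad_pair p t L x y)
  <= (L + 3)%:R * expR (2 * eta ^+ 2 * #|edges G|%:R - eta * t).
Proof.
move=> p01 eta0 eta2; set X := expR _.
have lam2 : `|eta| <= 1 / 2 by rewrite gtr0_norm.
have nlam2 : `|- eta| <= 1 / 2 by rewrite normrN.
have up a : t <= a -> eta * t <= eta * a by rewrite ler_pM2l.
have dn a : a <= - t -> eta * t <= - eta * a.
  by move=> at_; rewrite mulNr -mulrN ler_pM2l //; lra.
pose q : {set G} -> R := fun=> p.
pose S F := perc_cluster F x; pose T F := perc_cluster F y.
have b1 : Pr (edges G) q (fun F => deviation p (touch (T F)) F <= - t) <= X.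
  have := cluster_deviation (eta * t) y p01 nlam2; rewrite sqrrN.
  by apply: le_trans; apply: Pr_le => // F _ /dn.
have b2 : Pr (edges G) q (fun F => t <= deviation p (touch (T F)) F) <= X.
  have := cluster_deviation (eta * t) y p01 lam2.
  by apply: le_trans; apply: Pr_le => // F _ /up.
have b3 : Pr (edges G) q (fun F =>
    t <= deviation p ((edges G :\: touch (S F)) :&: touch (T F)) F) <= X.
  have := fresh_deviation (eta * t) x y p01 lam2
    (fun S => subxx (edges G :\: touch S)).
  by apply: le_trans; apply: Pr_le => // F _ /up.
have b4 k : Pr (edges G) q (fun F => deviation p
    ((touch (graph_ball k (S F)) :\: touch (S F)) :&: touch (T F)) F <= - t)
    <= X.
  have := fresh_deviation (eta * t) x y p01 nlam2
    (fun S => setSD (touch S) (touch_sub (graph_ball k S))); rewrite sqrrN.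
  by apply: le_trans; apply: Pr_le => // F _ /dn.
have -> : (L + 3)%:R * X = X + (X + (X + X *+ L)).
  by rewrite natrD mulrDl -[X *+ L]mulr_natl; ring.
do 3!(apply: (le_trans (Pr_or _ _ _ _)) => //; apply: lerD => //).
apply: le_trans (Pr_exists _ _ _) _ => //.
rewrite -[leRHS](_ : \sum_(k < L) X = _); last by rewrite sumr_const card_ord.
by apply: ler_sum => k _; apply: b4.
Qed.

(** * Growth of balls in an expander *)

Lemma expander_boundary (b : R) U : vertex_expander G b -> (0 < #|U|)%N ->
  #|U|%:R <= #|G|%:R / 2 :> R -> b * #|U|%:R <= #|ext_boundary U|%:R.
Proof.
move=> expG U0 U2; rewrite -ler_pdivlMr ?ltr0n // -lee_fin.
apply: le_trans expG _; apply: bigmin_le_cond.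
by rewrite U0 U2.
Qed.

(** While the complement has more than $cn/2$ vertices, each step adds at least $bcn/2$ vertices:
    expand the ball itself if it fills at most half of the graph, and otherwise the complement of
    the next ball. *)
Lemma ball_expansion (b c : R) S k : vertex_expander G b -> 0 < b -> 0 < c ->
  (0 < #|S|)%N -> c * #|G|%:R <= #|S|%:R ->
  #|~: graph_ball k S|%:R <= c / 2 * #|G|%:R \/
  k%:R * (b * c / 2) * #|G|%:R <= #|graph_ball k S|%:R.
Proof.
move=> expG b0 c0 S0 cS; set n := #|G|%:R.
have n0 : 0 <= n :> R by [].
elim: k => [|k [IHk|IHk]]; first by right; rewrite !mul0r.
  left; apply: le_trans IHk; rewrite ler_nat subset_leq_card // setCS.
  exact: ball_sub.
set B := graph_ball k S in IHk *; set B' := graph_ball k.+1 S.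
have B'E : B' = B :|: ext_boundary B by [].
have cB' : (#|B'| = #|B| + #|ext_boundary B|)%N.
  rewrite B'E cardsU (_ : B :&: _ = set0) ?cards0 ?subn0 //.
  by apply/setP => z; rewrite !inE; case: (z \in B).
have SB : (#|S| <= #|B|)%N by rewrite subset_leq_card // (@ball_sub _ k 0).
have [|cW] := leP #|~: B'|%:R (c / 2 * n); [by left | right].
suff grow : b * c / 2 * n <= #|ext_boundary B|%:R.
  by rewrite cB' natrD -natr1 [in leLHS]mulrDl [in leLHS]mulrDl mul1r lerD.
have [B2|B2] := leP (#|B|%:R : R) (n / 2).
  apply: le_trans (expander_boundary expG _ B2); last exact: leq_trans SB.
  have : c * n <= #|B|%:R by rewrite (le_trans cS) // ler_nat.
  have : 0 <= c * n by rewrite mulr_ge0 // ltW.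
  by nra.
have CW : (#|~: B'| + #|B'| = #|G|)%N by rewrite addnC cardsC.
have W0 : (0 < #|~: B'|)%N.
  by rewrite -(ltr0n R); apply: le_lt_trans cW;
     rewrite mulr_ge0 // divr_ge0 // ltW.
have CWr : #|~: B'|%:R + #|B'|%:R = n :> R by rewrite -natrD CW.
have BB' : #|B|%:R <= #|B'|%:R :> R by rewrite ler_nat cB' leq_addr.
have W2 : #|~: B'|%:R <= n / 2 by lra.
(* A vertex of [B'] with a neighbour outside [B'] cannot lie in [B], so it is one of the vertices
   just added. *)
have bd : (#|ext_boundary (~: B')| <= #|ext_boundary B|)%N.
  apply: subset_leq_card; apply/subsetP => z.
  rewrite [z \in _]in_set inE negbK => /andP[zB' /existsP[w /andP[]]].
  rewrite inE B'E => wB' wz.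
  move: zB'; rewrite B'E inE => /orP[zB|//].
  case/negP: wB'; rewrite inE; case: (boolP (w \in B)) => //= wB.
  by rewrite inE wB /=; apply/existsP; exists z; rewrite zB adj_sym.
apply: (@le_trans _ _ (#|ext_boundary (~: B')|%:R)); last by rewrite ler_nat.
apply: le_trans (expander_boundary expG W0 W2).
by rewrite -mulrA -mulrA ler_pM2l // mulrA; apply: ltW cW.
Qed.

End LargeClusters.

(** * Two distinct large clusters force a bad pair *)

Section TwoLargeClusters.
Variables (R : realType) (G : sgraph).
Implicit Types (F : {set {set G}}) (S T U W : {set G}) (x y : G) (p t : R).

(** An open edge touching [T] lies inside [T] and so misses [S]. Dropping the edges that touch [S]
    therefore keeps the open count, and the two estimates leave at most $2t/p$ edges touching both
    (for $p > 0$). These edges cover the vertices counted, two per edge. *)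
Lemma neighbour_ball_le p t F x y :
  let S := perc_cluster F x in let T := perc_cluster F y in
  0 <= p -> S != T -> - t <= deviation p (touch T) F ->
  deviation p ((edges G :\: touch S) :&: touch T) F <= t ->
  p * #|T :&: graph_ball 1 S|%:R <= 4 * t.
Proof.
move=> S T p0 neST lo up; have dST := cluster_disjoint neST.
have cov : (#|T :&: graph_ball 1 S| <= 2 * #|touch T :&: touch S|)%N.
  apply: card_le_cover => [|v /setIP[vT]].
    by rewrite (subset_trans (subsetIl _ _)) ?touch_sub.
  rewrite /= in_setU => /orP[vS|].
    by case/negP: (disjointFr dST vS).
  rewrite in_set => /andP[vS /existsP[u /andP[uS uv]]].
  exists [set u; v]; last by rewrite !inE eqxx orbT.
  by rewrite in_setI (adj_touchr uv vT) (adj_touch uv uS).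
have openE : ((edges G :\: touch S) :&: touch T) :&: F = touch T :&: F.
  apply/setP => e; rewrite 3!in_setI in_setD; case: (boolP (e \in F)) => eF.
    rewrite !andbT; case: (boolP (e \in touch T)) => eT; rewrite ?andbF //.
    rewrite (subsetP (touch_sub T) _ eT) !andbT.
    apply/negP => /touchP[_ [v ve vS]].
    have vT := subsetP (open_touch_sub eF eT) _ ve.
    by case/negP: (disjointFr dST vS).
  by rewrite !andbF.
have cT : (#|touch T| =
    #|touch T :&: touch S| + #|(edges G :\: touch S) :&: touch T|)%N.
  rewrite -(cardsID (touch S) (touch T)); congr (_ + _)%N; apply: eq_card.
  move=> e; rewrite in_setI 2!in_setD.
  case: (boolP (e \in touch T)) => eT; rewrite ?andbF //.
  by rewrite (subsetP (touch_sub T) _ eT) !andbT.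
move: lo up; rewrite /deviation openE cT natrD => lo up.
have := ler_wpM2l p0 (_ : #|T :&: graph_ball 1 S|%:R <=
   2 * #|touch T :&: touch S|%:R :> R).
rewrite -natrM ler_nat => /(_ cov); rewrite natrM; lra.
Qed.

(** Fresh edges touching both [T] and the ball [B] cover the new vertices of [T]. The open ones lie
    inside [T] and touch [T :&: B], so they number at most [Delta * #|T :&: B|]; the lower deviation
    bound then limits all of them. *)
Lemma next_ball_le p t F x y k Delta :
  let S := perc_cluster F x in let T := perc_cluster F y in
  (max_degree G <= Delta)%N -> 0 <= p ->
  - t <= deviation p ((touch (graph_ball k.+1 S) :\: touch S) :&: touch T) F ->
  p * #|T :&: graph_ball k.+2 S|%:R <=
  p * #|T :&: graph_ball k.+1 S|%:R
    + 2 * (Delta%:R * #|T :&: graph_ball k.+1 S|%:R + t).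
Proof.
move=> S T degD p0; set B := graph_ball k.+1 S; set B' := graph_ball k.+2 S.
set A := (_ :\: _) :&: _ => lo.
have cov : (#|(T :&: B') :\: B| <= 2 * #|A|)%N.
  apply: card_le_cover => [|v].
    by rewrite (subset_trans (subsetIr _ _)) ?touch_sub.
  rewrite in_setD in_setI => /andP[vB /andP[vT]].
  rewrite [B']/= -/(graph_ball k.+1 S) -/B in_setU (negPf vB) /=.
  rewrite in_set => /andP[_ /existsP[u /andP[uB uv]]].
  exists [set u; v]; last by rewrite !inE eqxx orbT.
  rewrite in_setI in_setD (adj_touch uv uB) (adj_touchr uv vT) !andbT.
  (* The edge misses [S]: otherwise [v] would be within distance 1 of [S], hence in [B], whose
     radius is at least 1. *)
  apply/negP => /touchP[_ [w]]; rewrite in_set2 => /orP[]/eqP-> wS; last first.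
    by case/negP: vB; apply: (subsetP (@ball_sub _ k.+1 0 S _)).
  case/negP: vB; apply: (subsetP (@ball_sub _ k.+1 1 S _)) => //=.
  rewrite in_setU; case: (boolP (v \in S)) => //= vS.
  by rewrite in_set vS; apply/existsP; exists u; rewrite wS.
have opn : (#|A :&: F| <= Delta * #|T :&: B|)%N.
  apply: leq_trans (card_touch _ degD); apply: subset_leq_card.
  apply/subsetP => e; rewrite 2!in_setI in_setD.
  case/andP=> /andP[/andP[_ /touchP[eE [v ve vB]]] eT] eF.
  apply/touchP; split=> //; exists v => //; rewrite in_setI vB andbT.
  exact: (subsetP (open_touch_sub eF eT)).
have cE : (#|T :&: B'| <= #|T :&: B| + #|(T :&: B') :\: B|)%N.
  rewrite -(cardsID B (T :&: B')) leq_add2r subset_leq_card //.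
  by rewrite setSI // subsetIl.
have cEr : #|T :&: B'|%:R <= #|T :&: B|%:R + 2 * #|A|%:R :> R.
  by rewrite -natrM -natrD ler_nat (leq_trans cE) // leq_add2l.
have := ler_wpM2l p0 cEr; move: lo; rewrite /deviation.
have : #|A :&: F|%:R <= Delta%:R * #|T :&: B|%:R :> R.
  by rewrite -natrM ler_nat.
lra.
Qed.

(** In a cluster with at least two vertices every vertex is an end of an open edge. *)
Lemma cluster_card_le p t F y Delta :
  let T := perc_cluster F y in
  (max_degree G <= Delta)%N -> 0 <= p -> (1 < #|T|)%N ->
  deviation p (touch T) F <= t ->
  #|T|%:R <= 2 * (p * (Delta%:R * #|G|%:R) + t).
Proof.
move=> T degD p0 T1 up.
have cov : (#|T| <= 2 * #|touch T :&: F|)%N.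
  apply: card_le_cover => [|v vT].
    by rewrite (subset_trans (subsetIl _ _)) ?touch_sub.
  have [w wT wv] : exists2 w, w \in T & w != v.
    have := cardsD1 v T; rewrite vT => cT; have : (0 < #|T :\ v|)%N by lia.
    case/card_gt0P => w; rewrite !inE => /andP[wv wT].
    by exists w; rewrite ?inE.
  have : w \in perc_cluster F v by rewrite (cluster_eq vT).
  rewrite inE => /connectP[[|u s] /=].
    by move=> _ wE; rewrite wE eqxx in wv.
  case/andP=> /andP[vu vuF] _ _; exists [set v; u]; last by rewrite !inE eqxx.
  by rewrite in_setI vuF adj_touch.
have : #|touch T|%:R <= Delta%:R * #|G|%:R :> R.
  rewrite -natrM ler_nat (leq_trans (card_touch _ degD)) //.
  by rewrite leq_mul2l max_card orbT.
move/(ler_wpM2l p0); move: up; rewrite /deviation.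
have : #|T|%:R <= 2 * #|touch T :&: F|%:R :> R by rewrite -natrM ler_nat.
lra.
Qed.

(* Bounds [#|T :&: graph_ball k.+1 S| / t] by iterating [next_ball_le]. *)
Fixpoint ball_factor (p0 : R) (Delta k : nat) : R :=
  if k is k'.+1 then
    let a := ball_factor p0 Delta k' in a + 2 * (Delta%:R * a + 1) / p0
  else 4 / p0.

Lemma ball_factor_ge0 (p0 : R) Delta k : 0 < p0 -> 0 <= ball_factor p0 Delta k.
Proof.
move=> p00; elim: k => [|k IHk] /=; first by rewrite divr_ge0 // ltW.
by rewrite addr_ge0 // divr_ge0 ?(ltW p00) // mulr_ge0 // addr_ge0 // mulr_ge0.
Qed.

Lemma ball_inter_le (p0 : R) p t F x y Delta L k :
  let S := perc_cluster F x in let T := perc_cluster F y in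
  (max_degree G <= Delta)%N -> 0 < p0 -> p0 <= p -> 0 <= t -> S != T ->
  ~~ bad_pair p t L x y F -> (k <= L)%N ->
  #|T :&: graph_ball k.+1 S|%:R <= ball_factor p0 Delta k * t.
Proof.
move=> S T degD p00 p0p t0 neST.
have p_0 : 0 <= p by apply: le_trans p0p; apply: ltW.
rewrite /bad_pair -/S -/T !negb_or -!ltNge => /and4P[b1 _ b3 b4].
have b4' j : (j < L)%N ->
    - t < deviation p ((touch (graph_ball j.+1 S) :\: touch S) :&: touch T) F.
  move=> jL; move: b4; rewrite negb_exists => /forallP/(_ (Ordinal jL)).
  by rewrite -ltNge.
elim: k => [_|k IHk kL].
  rewrite /= mulrAC ler_pdivlMr //.
  apply: le_trans (neighbour_ball_le p_0 neST (ltW b1) (ltW b3)).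
  by rewrite mulrC ler_wpM2r.
set a := ball_factor p0 Delta k.+1; rewrite /= in a *.
have IH := IHk (ltnW kL); have := next_ball_le degD p_0 (ltW (b4' _ kL)).
set m' := #|_|%:R; set m := #|_|%:R in IH * => bm.
have -> : a * t = ball_factor p0 Delta k * t +
   (2 * (Delta%:R * (ball_factor p0 Delta k * t) + t)) / p0.
  by rewrite /a; field; apply: lt0r_neq0.
set at_ := ball_factor p0 Delta k * t in IH *.
(* Replacing [p] by the smaller [p0] makes the factor uniform in [p]; it is legitimate for a
   nonnegative increment, and a negative one is trivial. *)
have dm : p0 * (m' - m) <= 2 * (Delta%:R * at_ + t).
  have Dm : Delta%:R * m <= Delta%:R * at_ by rewrite ler_wpM2l.
  have [mm|mm] := leP m m'.
    have : p0 * (m' - m) <= p * (m' - m) by rewrite ler_wpM2r // subr_ge0.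
    by lra.
  have : p0 * (m' - m) <= 0 by rewrite nmulr_lle0 ?subr_lt0 // ltW.
  have : 0 <= Delta%:R * at_.
    by rewrite mulr_ge0 // mulr_ge0 // ball_factor_ge0.
  by lra.
rewrite mulrC -ler_pdivlMr // in dm.
lra.
Qed.

(** If the pair is not bad and [p < p0], then [T] has fewer than $cn$ vertices. If [p0 <= p], fewer
    than $cn/2$ vertices of [T] lie in the ball of radius [L.+1] and at most $cn/2$ lie outside
    it. *)
Lemma two_large_clusters_bad (b c d p0 p : R) F x y Delta L :
  let S := perc_cluster F x in let T := perc_cluster F y in
  let n : R := #|G|%:R in
  (max_degree G <= Delta)%N -> vertex_expander G b ->
  0 < b -> 0 < c -> 0 < p0 -> 0 < d -> 0 <= p -> 1 < c * n ->
  2 * (p0 * Delta%:R + d) < c -> ball_factor p0 Delta L * d < c / 2 ->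
  1 < L.+1%:R * (b * c / 2) ->
  S != T -> c * n <= #|S|%:R -> c * n <= #|T|%:R ->
  bad_pair p (d * n) L x y F.
Proof.
move=> S T n degD expG b0 c0 p00 d0 p_0 cn1 small large Lbig neST cS cT.
have n0 : 0 < n by rewrite -(pmulr_rgt0 _ c0); lra.
have t0 : 0 <= d * n by rewrite mulr_ge0 // ltW.
apply/negPn/negP => nbad.
have [p0p|pp0] := leP p0 p; last first.
  move: nbad; rewrite /bad_pair !negb_or -!ltNge => /and4P[_ b2 _ _].
  have T1 : (1 < #|T|)%N by rewrite -(ltr1n R); lra.
  have := cluster_card_le degD p_0 T1 (ltW b2).
  have : p * (Delta%:R * n) <= p0 * (Delta%:R * n).
    by rewrite ler_wpM2r ?mulr_ge0 // ltW.
  have : 2 * (p0 * Delta%:R + d) * n < c * n by rewrite ltr_pM2r.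
  by rewrite -/n; lra.
have mL := ball_inter_le degD p00 p0p t0 neST nbad (leqnn L).
have S0 : (0 < #|S|)%N by rewrite -(ltr0n R); lra.
(* The other alternative of [ball_expansion] would give a ball with more than [n] vertices. *)
have Ble : #|~: graph_ball L.+1 S|%:R <= c / 2 * n.
  case: (ball_expansion L.+1 expG b0 c0 S0 cS) => // big.
  have : #|graph_ball L.+1 S|%:R <= n by rewrite ler_nat max_card.
  have : 1 * n < L.+1%:R * (b * c / 2) * n by rewrite ltr_pM2r.
  by rewrite -/n in big; lra.
have cT' : (#|T| <= #|T :&: graph_ball L.+1 S| + #|~: graph_ball L.+1 S|)%N.
  rewrite -(cardsID (graph_ball L.+1 S) T) leq_add2l subset_leq_card //.
  by rewrite setDE subsetIr.
have cTr : #|T|%:R <=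
    #|T :&: graph_ball L.+1 S|%:R + #|~: graph_ball L.+1 S|%:R :> R.
  by rewrite -natrD ler_nat.
have : ball_factor p0 Delta L * d * n < c / 2 * n by rewrite ltr_pM2r.
by rewrite -/S -/T in mL cTr *; lra.
Qed.

(** * Union bound over pairs of vertices *)

Lemma several_large_clusters (s : R) F :
  several_large_components s (spanning_subgraph F) ->
  exists x y, [/\ perc_cluster F x != perc_cluster F y,
    s <= #|perc_cluster F x|%:R & s <= #|perc_cluster F y|%:R].
Proof.
rewrite /several_large_components => /card_gt1P[C [C' []]].
rewrite !inE => /andP[/imsetP[x _ ->] sx] /andP[/imsetP[y _ ->] sy] neC.
by exists x, y.
Qed.

Lemma perc_prob_several_large (b c d p0 eta p : R) Delta L :
  let n : R := #|G|%:R in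
  (max_degree G <= Delta)%N -> vertex_expander G b ->
  0 < b -> 0 < c -> 0 < p0 -> 0 < d -> 0 <= p <= 1 -> 1 < c * n ->
  2 * (p0 * Delta%:R + d) < c -> ball_factor p0 Delta L * d < c / 2 ->
  1 < L.+1%:R * (b * c / 2) ->
  0 < eta -> eta <= 1 / 2 -> 4 * eta * Delta%:R <= d ->
  perc_prob G p (several_large_components (c * n))
  <= n ^+ 2 * ((L + 3)%:R * expR (- (eta * d / 2 * n))).
Proof.
move=> n degD expG b0 c0 p00 d0 p01 cn1 small large Lbig eta0 eta2 etad.
have p_0 : 0 <= p by case/andP: p01.
have n0 : 0 < n by rewrite -(pmulr_rgt0 _ c0); lra.
have pairs : perc_prob G p (several_large_components (c * n)) <=
    Pr (edges G) (fun=> p) (fun F => [exists xy : G * G,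
      bad_pair p (d * n) L xy.1 xy.2 F]).
  apply: (@Pr_le _ _ (edges G) (fun=> p)) => // F _ /several_large_clusters.
  case=> x [y [neST cS cT]]; apply/existsP; exists (x, y).
  exact: (two_large_clusters_bad degD expG b0 c0 p00 d0).
apply: le_trans pairs _; apply: le_trans (Pr_exists _ _ _) _ => //.
apply: (@le_trans _ _ (\sum_(xy : G * G)
    (L + 3)%:R * expR (- (eta * d / 2 * n)))); last first.
  by rewrite sumr_const card_prod -[_ *+ (_ * _)]mulr_natl natrM -expr2.
apply: ler_sum => -[x y] _ /=.
apply: le_trans (bad_pair_prob _ _ _ _ p01 eta0 eta2) _.
rewrite ler_wpM2l // ler_expR.
have : #|edges G|%:R <= Delta%:R * n :> R.
  by rewrite -touchT -natrM ler_nat (leq_trans (card_touch _ degD)) // cardsT.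
set m := #|edges G|%:R => mD.
have e1 : eta ^+ 2 * m <= eta ^+ 2 * (Delta%:R * n).
  by rewrite ler_wpM2l ?sqr_ge0.
(* The term [2 * eta ^+ 2 * #|edges G|] thus uses up at most half of the gain [eta * d * n]. *)
have e2 : eta * n * (4 * eta * Delta%:R) <= eta * n * d.
  by rewrite ler_wpM2l // mulr_ge0 // ltW.
lra.
Qed.

End TwoLargeClusters.

(** * Choice of the constants and the limit *)

Local Open Scope classical_set_scope.

Theorem theorem2p1 (R : realType) (b : R) (Delta : nat) (G : nat -> sgraph)
    (p : nat -> R) (c : R) :
  0 < b ->
  (forall n, (1 <= n)%N -> (max_degree (G n) <= Delta)%N) ->
  (forall n, (1 <= n)%N -> vertex_expander (G n) b) ->
  (#|G n|%:R : R) @[n --> \oo] --> +oo ->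
  (forall n, (1 <= n)%N -> 0 <= p n <= 1) ->
  0 < c ->
  perc_prob (G n) (p n) (several_large_components (c * #|G n|%:R))
    @[n --> \oo] --> (0 : R).
Proof.
move=> b0 degD expG cardG p01 c0.
(* [D1] serves as a divisor since [Delta] may be 0. The choice of [p0] makes [p0 * Delta] less than
   $c/8$. *)
pose D1 : R := Delta%:R + 1; have D10 : 0 < D1 by rewrite ltr_wpDl.
pose p0 := c / (8 * D1); have p00 : 0 < p0 by rewrite divr_gt0 // mulr_gt0.
have bc0 : 0 < b * c / 2 by rewrite divr_gt0 // mulr_gt0.
(* After [L.+1] steps, growth by $bcn/2$ per step would exceed the whole graph. *)
have [L Lbig] : exists L : nat, 1 < L.+1%:R * (b * c / 2).
  exists (Num.truncn ((b * c / 2)^-1)).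
  rewrite -ltr_pdivrMr // mul1r; apply: truncnS_gt.
have a0 := ball_factor_ge0 Delta L p00; set a := ball_factor _ _ _ in a0.
(* [d] is chosen after [L] so that both [d] and [a * d] are at most $c/8$. *)
pose d := c / (8 * (a + 1)).
have a1 : 0 < a + 1 by rewrite ltr_wpDl.
have d0 : 0 < d by rewrite divr_gt0 // mulr_gt0.
have dE : d * a + d = c / 8 by rewrite /d; field; apply: lt0r_neq0.
have p0E : p0 * Delta%:R + p0 = c / 8.
  by rewrite /p0 /D1; field; apply: lt0r_neq0.
have da0 : 0 <= d * a by rewrite mulr_ge0 // ltW.
(* The first bound is the range of validity of [chernoff]; the second keeps the quadratic term below
   half of the gain. *)
pose eta := Num.min (1 / 2) (d / (4 * D1)).
have eta0 : 0 < eta by rewrite lt_min divr_gt0 //= divr_gt0 // mulr_gt0.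
have eta2 : eta <= 1 / 2 by rewrite ge_min lexx.
have etad : 4 * eta * Delta%:R <= d.
  have : eta <= d / (4 * D1) by rewrite ge_min lexx orbT.
  rewrite ler_pdivlMr ?mulr_gt0 // /D1; lra.
pose kap := eta * d / 2.
have kap0 : 0 < kap by rewrite divr_gt0 // mulr_gt0.
(* From $e^x \ge x^3/6$: the cube beats the $N^2$ pairs and leaves the bound [C / N]. *)
pose C : R := (L + 3)%:R * 6 / kap ^+ 3.
have C0 : 0 < C by rewrite divr_gt0 ?exprn_gt0 // mulr_gt0 // ltr0n addn3.
apply/cvgr0Pnorm_lt => e e0; near=> n.
have n1 : (1 <= n)%N by near: n; exists 1%N.
have cn : c^-1 < #|G n|%:R by near: n; move/cvgryPgt: cardG; apply.
have ce : C / e < #|G n|%:R by near: n; move/cvgryPgt: cardG; apply.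
have N0 : 0 < #|G n|%:R :> R by apply: lt_trans cn; rewrite invr_gt0.
rewrite ger0_norm; last first.
  by apply: sumr_ge0 => F _;
     apply: (@mass_ge0 _ _ _ (fun=> p n)) => ?; apply: p01.
have := @perc_prob_several_large R (G n) b c d p0 eta (p n) Delta L
  (degD _ n1) (expG _ n1) b0 c0 p00 d0 (p01 _ n1).
rewrite -/kap; set N := #|G n|%:R in cn ce N0 *.
have cN1 : 1 < c * N by rewrite mulrC -ltr_pdivrMr // div1r.
move=> /(_ cN1) H.
apply: le_lt_trans (H _ _ Lbig eta0 eta2 etad) _; [lra|rewrite -/a; lra|].
apply: (@le_lt_trans _ _ (C / N)); last first.
  by rewrite ltr_pdivrMr // mulrC -ltr_pdivrMr.
have kN : 0 < kap * N by rewrite mulr_gt0.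
have := expR_ge1Dxn 2 (ltW kN); rewrite expRN => ex.
have ex3 : (kap * N) ^+ 3 / 6 <= expR (kap * N).
  by apply: le_trans ex; rewrite lerDr.
have inv : (expR (kap * N))^-1 <= 6 / (kap * N) ^+ 3.
  by rewrite -[leRHS]invf_div lef_pV2 ?posrE ?expR_gt0 ?divr_gt0 ?exprn_gt0.
have -> : C / N = N ^+ 2 * ((L + 3)%:R * (6 / (kap * N) ^+ 3)).
  by rewrite /C; field; rewrite !lt0r_neq0.
by rewrite ler_wpM2l ?sqr_ge0 // ler_wpM2l.
Unshelve. all: by end_near.
Qed.
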